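(* Let $\Phi:\mathbb{R}^{d}\rightrightarrows\mathbb{R}^{\ell}$ be a cusco map. Then $\Phi$ is Filippov representable if and only if $\Phi=m(\Phi)$, that is, $\Phi(x)=m(\Phi)(x)$ for all $x\in\mathbb{R}^d$ (equivalently, $\Phi$ is the $\preceq$-minimal element of its equivalence class $[\Phi]$).
   Context: $\mathcal{N}$ denotes the family of Lebesgue null subsets of $\mathbb{R}^d$, and $B_\delta(x)$ is the open ball of center $x$ and radius $\delta$. $\Phi:\mathbb{R}^{d}\rightrightarrows\mathbb{R}^{\ell}$ means that $\Phi$ is a set-valued map assigning to each $x\in\mathbb{R}^d$ a subset $\Phi(x)\subset\mathbb{R}^\ell$; for $A\subset\mathbb{R}^d$, $\Phi(A)=\bigcup_{x\in A}\Phi(x)$. A set-valued map is called cusco if it is upper semicontinuous and has nonempty compact convex values. $\overline{\mathrm{co}}$ denotes the closed convex hull. Measurable means Lebesgue measurable. The Filippov regularization of a measurable function $f:\mathbb{R}^d\to\mathbb{R}^\ell$ is $$F_f(x):=\bigcap_{N\in\mathcal{N}}\bigcap_{\delta>0}\overline{\mathrm{co}}\,f(B_\delta(x)\setminus N),\quad x\in\mathbb{R}^d.$$ A cusco map $\Phi$ is called Filippov representable if there exists a (single-valued) measurable function $f:\mathbb{R}^d\to\mathbb{R}^\ell$ such that $\Phi(x)=F_f(x)$ for all $x\in\mathbb{R}^d$. For a cusco map $\Phi$ define $$m(\Phi)(x):=\bigcap_{N\in\mathcal{N}}\bigcap_{\delta>0}\overline{\mathrm{co}}\,\Phi(B_\delta(x)\setminus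 N),\quad x\in\mathbb{R}^d.$$ For cusco maps $\Phi_1,\Phi_2:\mathbb{R}^{d}\rightrightarrows\mathbb{R}^{\ell}$, write $\Phi_1\sim\Phi_2$ if $\Phi_1(x)=\Phi_2(x)$ for almost all $x\in\mathbb{R}^d$; $[\Phi]$ is the set of cusco maps $\Psi:\mathbb{R}^{d}\rightrightarrows\mathbb{R}^{\ell}$ with $\Psi\sim\Phi$. Write $\Phi_1\preceq\Phi_2$ if $\Phi_1(x)\subseteq\Phi_2(x)$ for all $x\in\mathbb{R}^d$. *)

(* Defs.v *)
From mathcomp Require Import all_boot all_order all_algebra.
From mathcomp Require Import all_classical all_reals all_analysis.

Set Implicit Arguments.
Unset Strict Implicit.
Unset Printing Implicit Defensive.

Import Order.TTheory GRing.Theory Num.Theory.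
Import numFieldNormedType.Exports.

Local Open Scope classical_set_scope.
Local Open Scope ring_scope.

Section lebesgue_space.
Context {R : realType} {d : nat}.
Implicit Types (a b x : 'rV[R]_d) (A N : set 'rV[R]_d).

(* MathComp-Analysis puts the sup norm on 'rV[R]_d, whence an explicit
   definition; the topology is the same. *)
Definition euclidean_ball x (delta : R) : set 'rV[R]_d :=
  [set y : 'rV[R]_d | Num.sqrt (\sum_(i < d) (y 0 i - x 0 i) ^+ 2) < delta].

Definition box a b : set 'rV[R]_d :=
  [set y : 'rV[R]_d | forall i, y 0 i \in `]a 0 i, b 0 i]].

Definition box_volume a b : R := \prod_(i < d) (b 0 i - a 0 i).

Definition box_covers A : set (nat -> 'rV[R]_d * 'rV[R]_d) :=
  [set c : nat -> 'rV[R]_d * 'rV[R]_d |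
    (forall k i, (c k).1 0 i <= (c k).2 0 i) /\
    A `<=` \bigcup_k box (c k).1 (c k).2].

(* For d = 0 the only box is the whole space, of volume 1, and no set would be
   null: these definitions are meant for 0 < d. *)
Definition lebesgue_outer A : \bar R :=
  ereal_inf [set (\sum_(0 <= k <oo) (box_volume (c k).1 (c k).2)%:E)%E
            | c in box_covers A].

Definition lebesgue_null N : Prop := lebesgue_outer N = 0%E.

Definition lebesgue_measurable A : Prop := lebesgue_outer.-caratheodory A.

End lebesgue_space.

Definition lebesgue_measurable_fun {R : realType} {d l : nat}
    (f : 'rV[R]_d -> 'rV[R]_l) : Prop :=
  forall U : set 'rV[R]_l, open U -> lebesgue_measurable (f @^-1` U).

Definition closed_convex_hull {R : realType} {l : nat} (A : set 'rV[R]_l) :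
    set 'rV[R]_l :=
  smallest [set C : set 'rV[R]_l | closed C /\ convex_set C] A.

Section set_valued_maps.
Context {R : realType} {d l : nat}.
Implicit Types (Phi Psi : 'rV[R]_d -> set 'rV[R]_l) (f : 'rV[R]_d -> 'rV[R]_l).

Definition upper_semicontinuous_map Phi : Prop :=
  forall x (V : set 'rV[R]_l), open V -> Phi x `<=` V ->
    \forall y \near x, Phi y `<=` V.

Definition cusco Phi : Prop :=
  upper_semicontinuous_map Phi /\
  forall x, [/\ Phi x !=set0, compact (Phi x) & convex_set (Phi x)].

Definition filippov_regularization f : 'rV[R]_d -> set 'rV[R]_l := fun x =>
  \bigcap_(N in lebesgue_null) \bigcap_(delta in [set r : R | 0 < r])
    closed_convex_hull (f @` (euclidean_ball x delta `\` N)).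

Definition filippov_representable Phi : Prop :=
  exists f, lebesgue_measurable_fun f /\
    forall x, Phi x = filippov_regularization f x.

Definition m_map Phi : 'rV[R]_d -> set 'rV[R]_l := fun x =>
  \bigcap_(N in lebesgue_null) \bigcap_(delta in [set r : R | 0 < r])
    closed_convex_hull (\bigcup_(y in euclidean_ball x delta `\` N) Phi y).

Definition ae_equal Phi Psi : Prop :=
  lebesgue_null [set x | Phi x <> Psi x].

Definition cusco_class Phi : set ('rV[R]_d -> set 'rV[R]_l) :=
  [set Psi | cusco Psi /\ ae_equal Psi Phi].

Definition map_le Phi Psi : Prop := forall x, Phi x `<=` Psi x.

Definition is_least_in_class Phi : Prop :=
  forall Psi, cusco_class Phi Psi -> map_le Phi Psi.

Definition is_minimal_in_class Phi : Prop :=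
  forall Psi, cusco_class Phi Psi -> map_le Psi Phi -> Psi = Phi.

End set_valued_maps.

(* Main.v *)
Require Import Defs.
From HB Require Import structures.
From mathcomp Require Import all_boot all_order all_algebra.
From mathcomp Require Import all_classical all_reals all_analysis.
From mathcomp Require Import ring lra.

Set Implicit Arguments.
Unset Strict Implicit.
Unset Printing Implicit Defensive.

Import Order.TTheory GRing.Theory Num.Theory.
Import numFieldNormedType.Exports.

Local Open Scope classical_set_scope.
Local Open Scope ring_scope.

(** The theorem says that a cusco map is a Filippov regularization exactly when
    it is a fixed point of m.  The single-valued regularization F_f is m applied
    to the singleton-valued map y |-> {f y}, so everything is about m.

    Two general facts about m, valid for arbitrary set-valued maps, do most
    of the work. Both rest on the topologies having countable bases and on
    countable unions of null sets being null. For closed rational boxes p of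
    the source and q of the target, let hits G p q be the set of the y in p
    for which G y meets q. If G x is not contained in m(G)(x), then x lies
    in a null set hits G p q; these null sets are countably many, whence G x
    is contained in m(G)(x) for almost every x (ae_sub_m_map). Similarly
    m(G) is contained in m(H) as soon as every pair (p, q) for which hits H
    p q is null has hits G p q null (m_map_le_hits); in particular m is
    monotone with respect to inclusion almost everywhere (m_map_le_ae).

    For a cusco map Phi, upper semicontinuity gives the inclusion of m(Phi) in
    Phi (m_map_le_cusco), hence equality almost everywhere.  Moreover m(Phi) is
    cusco: values of Phi near x stay in one compact convex set, so a directed
    intersection of hulls contained in an open set has a member contained in it
    (m_map_sub_open); this yields upper semicontinuity, and nonemptiness because
    a ball is not null.  So m(Phi) belongs to the class of Phi, and it is below
    every element of that class, which settles the order-theoretic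
    characterizations.

    If Phi = F_f, then f x belongs to Phi x for almost every x, so
    Phi = m({f}) is below m(Phi).  Conversely, assume that Phi = m(Phi).  It
    suffices to find a measurable selection f of Phi such that hits {f} p q is
    not null whenever hits Phi p q is not null, for then m(Phi) is below F_f
    (rich_selection).  The countably many non-null sets hits Phi p q contain
    pairwise disjoint measurable non-null subsets (disjoint_pieces); on the
    subset attached to (p, q) the selection is made inside Phi y and q, and
    elsewhere inside Phi y.  The point of least Euclidean norm of a compact
    convex set provides the measurable selection (measurable_selection).

    What remains is the basic theory of the outer measure: it is countably
    subadditive, closed sets are Caratheodory measurable because half-spaces cut
    boxes additively, and nonempty boxes are not null (box_not_null). *)

(** * The Lebesgue outer measure is an outer measure *)

Lemma nneseries_pair (R : realType) (h : nat -> nat * nat) (u : nat -> nat -> \bar R) :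
  bijective h -> (forall i j, (0 <= u i j)%E) ->
  (\sum_(0 <= k <oo) u (h k).1 (h k).2 =
   \sum_(0 <= i <oo) \sum_(0 <= j <oo) u i j)%E.
Proof.
move=> bh u0; rewrite nneseries_esumT; last by move=> k; exact: u0.
rewrite nneseries_esumT; last by move=> i; apply: nneseries_ge0 => j _ _; exact: u0.
under [RHS]eq_esum => i _ do rewrite nneseries_esumT//.
rewrite esum_esum//.
rewrite (@reindex_esum R nat (nat * nat)%type setT _ h
  (fun k => u k.1 k.2))//.
split => //.
- by move=> x y _ _; exact: (bij_inj bh).
- move=> y _; have [g hg gh] := bh; exists (g y) => //=; exact: gh.
Qed.

Section outer_measure_of_boxes.
Context {R : realType} {n : nat}.
Local Notation d := n.+1.
Implicit Types (a b x y : 'rV[R]_d) (A B X : set 'rV[R]_d).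

Lemma box_volume_ge0 a b : (forall i, a 0 i <= b 0 i) -> 0 <= box_volume a b.
Proof. by move=> ab; apply: prodr_ge0 => i _; rewrite subr_ge0. Qed.

Lemma box_volumexx a : box_volume a a = 0.
Proof. by rewrite /box_volume big_ord_recl subrr mul0r. Qed.

Lemma box_series_ge0 (c : nat -> 'rV[R]_d * 'rV[R]_d) :
  (forall k i, (c k).1 0 i <= (c k).2 0 i) ->
  (0 <= \sum_(0 <= k <oo) (box_volume (c k).1 (c k).2)%:E)%E.
Proof.
by move=> ck; apply: nneseries_ge0 => k _ _; rewrite lee_fin box_volume_ge0.
Qed.

Lemma lebesgue_outer_le A (c : nat -> 'rV[R]_d * 'rV[R]_d) :
  box_covers A c ->
  (lebesgue_outer A <= \sum_(0 <= k <oo) (box_volume (c k).1 (c k).2)%:E)%E.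
Proof. by move=> Ac; apply: ereal_inf_lbound; exists c. Qed.

Lemma lebesgue_outer_ge0 A : (0 <= lebesgue_outer A)%E.
Proof.
by apply: le_ereal_inf_tmp => _ [c [ck _] <-]; exact: box_series_ge0.
Qed.

Lemma le_lebesgue_outer A B : A `<=` B -> (lebesgue_outer A <= lebesgue_outer B)%E.
Proof.
move=> AB; apply: ereal_inf_le_tmp => _ [c [ck Bc] <-]; exists c => //.
by split=> //; exact: subset_trans AB Bc.
Qed.

(** The cover is completed by boxes with equal corners, whose volume is zero
    only because the dimension is positive. *)
Lemma lebesgue_outer_box_le a b : (forall i, a 0 i <= b 0 i) ->
  (lebesgue_outer (box a b) <= (box_volume a b)%:E)%E.
Proof.
move=> ab; pose c k := if k is 0%N then (a, b) else (a, a).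
have cP : box_covers (box a b) c.
  by split=> [[|k] i//=|y aby]; exists 0%N.
apply: (le_trans (lebesgue_outer_le cP)).
rewrite nneseries_recl//; last first.
  by move=> k _; rewrite lee_fin box_volume_ge0// => i; exact: cP.1.
by rewrite eseries0 ?adde0// => -[|k]//= _ _; rewrite box_volumexx.
Qed.

Lemma lebesgue_outer0 : lebesgue_outer (set0 : set 'rV[R]_d) = 0%E.
Proof.
apply/eqP; rewrite eq_le lebesgue_outer_ge0 andbT.
rewrite -[leRHS](_ : (box_volume (0 : 'rV[R]_d) 0)%:E = _)%E; last first.
  by rewrite box_volumexx.
by apply: le_trans (le_lebesgue_outer _) (lebesgue_outer_box_le _) => //; exact: sub0set.
Qed.

(** Near-optimal covers of the sets A k, with errors e / 2 ^ (k + 1), are merged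
    into one cover along a bijection between nat and nat * nat. *)
Lemma lebesgue_outer_sigma_subadditive :
  sigma_subadditive (lebesgue_outer : set 'rV[R]_d -> \bar R).
Proof.
move=> A; have [[i ioo]|] := pselect (exists i, lebesgue_outer (A i) = +oo%E).
  rewrite (eseries_pinfty _ _ ioo) ?leey// => k _.
  by rewrite -ltNye (lt_le_trans _ (lebesgue_outer_ge0 _)).
rewrite -forallNE => Aoo; apply/lee_addgt0Pr => e e0.
rewrite (le_trans _ (epsilon_trick _ _ (ltW e0)))//; last first.
  by move=> k; exact: lebesgue_outer_ge0.
have /choice[c cP] k : exists c, box_covers (A k) c /\
    (\sum_(0 <= j <oo) (box_volume (c j).1 (c j).2)%:E <=
     lebesgue_outer (A k) + (e / (2 ^ k.+1)%:R)%:E)%E.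
  have Afin : lebesgue_outer (A k) \is a fin_num.
    by rewrite ge0_fin_numE ?lebesgue_outer_ge0// ltey; apply/eqP/Aoo.
  have ek : 0 < e / (2 ^ k.+1)%:R by rewrite divr_gt0// ltr0n expn_gt0.
  have [_ [c Ac <-] cA] := lb_ereal_inf_adherent ek Afin.
  by exists c; split=> //; exact: ltW.
have /card_esym/ppcard_eqP[f] := card_nat2.
pose h := f : nat -> nat * nat.
have hbij : bijective h.
  by rewrite -setTT_bijective; exact: bij.
have c0 i j : (0 <= (box_volume (c i j).1 (c i j).2)%:E)%E.
  by rewrite lee_fin box_volume_ge0// => l; exact: (cP i).1.1.
apply: (@le_trans _ _ (\sum_(0 <= k <oo)
    (box_volume (c (h k).1 (h k).2).1 (c (h k).1 (h k).2).2)%:E)%E).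
  apply: (@lebesgue_outer_le _ (fun k => c (h k).1 (h k).2)); split.
    by move=> k i; exact: (cP _).1.1.
  move=> x [i _ Aix]; have [j _ xij] := (cP i).1.2 _ Aix.
  have [g hg gh] := hbij; exists (g (i, j)) => //=.
  by rewrite gh.
rewrite (nneseries_pair (u := fun i j => (box_volume (c i j).1 (c i j).2)%:E))//.
apply: lee_nneseries => [i _ _|i _]; last exact: (cP i).2.
by apply: nneseries_ge0 => j _ _.
Qed.

HB.instance Definition _ := isOuterMeasure.Build R 'rV[R]_d lebesgue_outer
  lebesgue_outer0 lebesgue_outer_ge0 le_lebesgue_outer
  lebesgue_outer_sigma_subadditive.

Lemma lebesgue_null0 : lebesgue_null (set0 : set 'rV[R]_d).
Proof. exact: lebesgue_outer0. Qed.

Lemma lebesgue_nullS A B : A `<=` B -> lebesgue_null B -> lebesgue_null A.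
Proof.
move=> AB B0; apply/eqP; rewrite eq_le lebesgue_outer_ge0 andbT -B0.
exact: le_lebesgue_outer.
Qed.

Lemma lebesgue_null_bigcup (N : nat -> set 'rV[R]_d) :
  (forall k, lebesgue_null (N k)) -> lebesgue_null (\bigcup_k N k).
Proof.
move=> N0; apply/eqP; rewrite eq_le lebesgue_outer_ge0 andbT.
apply: (le_trans (lebesgue_outer_sigma_subadditive N)).
by rewrite eseries0// => k _ _; exact: N0.
Qed.

Lemma lebesgue_null_bigcup_count (I : countType) (P : set I) (N : I -> set 'rV[R]_d) :
  (forall i, P i -> lebesgue_null (N i)) -> lebesgue_null (\bigcup_(i in P) N i).
Proof.
move=> N0.
pose M k := if unpickle k is Some i then (if `[< P i >] then N i else set0) else set0.
apply: (@lebesgue_nullS _ (\bigcup_k M k)).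
  move=> x [i Pi Nix]; exists (pickle i) => //.
  by rewrite /M pickleK; case: asboolP.
apply: lebesgue_null_bigcup => k; rewrite /M; case: unpickle => [i|].
  by case: asboolP => [/N0//|_]; exact: lebesgue_null0.
exact: lebesgue_null0.
Qed.

Lemma lebesgue_nullU A B : lebesgue_null A -> lebesgue_null B ->
  lebesgue_null (A `|` B).
Proof.
move=> A0 B0; rewrite -bigcup2E; apply: lebesgue_null_bigcup => -[|[|k]]//=.
Qed.

End outer_measure_of_boxes.

(** * Cutting boxes along hyperplanes *)

Section cutting_boxes.
Context {R : realType} {n : nat}.
Local Notation d := n.+1.
Implicit Types (a b p q x y : 'rV[R]_d) (A B X : set 'rV[R]_d).

Definition update a (i : 'I_d) (m : R) : 'rV[R]_d :=
  \row_j (if j == i then m else a 0 j).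

Lemma updateE a i m j : update a i m 0 j = if j == i then m else a 0 j.
Proof. by rewrite mxE. Qed.

(** Cutting at m is additive for every m, inside the box or not, because the
    factor of coordinate i is the only one that changes and it is affine. *)
Lemma box_volume_cut a b i m :
  box_volume a (update b i m) + box_volume (update a i m) b = box_volume a b.
Proof.
rewrite /box_volume (bigD1 i)//= [X in _ + X](bigD1 i)//= [RHS](bigD1 i)//=.
rewrite !updateE eqxx.
rewrite (eq_bigr (fun j => b 0 j - a 0 j)); last first.
  by move=> j /negbTE ji; rewrite updateE ji.
rewrite [X in _ + _ * X](eq_bigr (fun j => b 0 j - a 0 j)); last first.
  by move=> j /negbTE ji; rewrite updateE ji.
by rewrite -mulrDl; congr (_ * _); ring.
Qed.

Definition clamp (a b c : R) := Num.min b (Num.max a c).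

Lemma clamp_ge (a b c : R) : a <= b -> a <= clamp a b c.
Proof. by move=> ab; rewrite /clamp le_min ab le_max lexx. Qed.

Lemma clamp_le (a b c : R) : clamp a b c <= b.
Proof. by rewrite /clamp ge_min lexx. Qed.

(** The hyperplane cuts each box of a cover of X into two boxes with the same
    total volume; the cutting height is clamped into the box so that both parts
    have ordered corners. *)
Lemma halfspace_measurable (i : 'I_d) (c : R) :
  lebesgue_measurable [set y : 'rV[R]_d | y 0 i <= c].
Proof.
apply: le_caratheodory_measurable => X.
apply: le_ereal_inf_tmp => _ [k [kle Xk] <-].
pose m j := clamp ((k j).1 0 i) ((k j).2 0 i) c.
have X1 : box_covers (X `&` [set y | y 0 i <= c])
    (fun j => ((k j).1, update (k j).2 i (m j))).
  split=> [j l/=|x [/Xk [j _ kjx]/= xc]].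
    by rewrite updateE; case: eqP => // ->; exact: clamp_ge.
  exists j => // l /=; rewrite updateE; case: eqP => [->|_]; last exact: kjx.
  have := kjx i; rewrite !in_itv/= => /andP[-> xk] /=.
  by rewrite /m /clamp le_min xk le_max xc orbT.
have X2 : box_covers (X `&` ~` [set y | y 0 i <= c])
    (fun j => (update (k j).1 i (m j), (k j).2)).
  split=> [j l/=|x [/Xk [j _ kjx]/= /negP]].
    by rewrite updateE; case: eqP => // ->; exact: clamp_le.
  rewrite -ltNge => xc.
  exists j => // l /=; rewrite updateE; case: eqP => [->|_]; last exact: kjx.
  have := kjx i; rewrite !in_itv/= => /andP[kx xk]; rewrite xk andbT.
  by rewrite /m /clamp gt_min gt_max kx xc orbT.
apply: (le_trans (leeD (lebesgue_outer_le X1) (lebesgue_outer_le X2))).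
rewrite -nneseriesD/=; last 2 first.
- by move=> j _ _; rewrite lee_fin; apply: box_volume_ge0; exact: X1.1.
- by move=> j _ _; rewrite lee_fin; apply: box_volume_ge0; exact: X2.1.
by under eq_eseriesr => j _ do rewrite -EFinD box_volume_cut.
Qed.

(** The volume of the intersection of two boxes; truncating each factor at zero
    accounts for boxes that do not meet. *)
Definition overlap p q a b : R :=
  \prod_(i < d) Num.max 0 (Num.min (b 0 i) (q 0 i) - Num.max (a 0 i) (p 0 i)).

Lemma overlap_ge0 p q a b : 0 <= overlap p q a b.
Proof. by apply: prodr_ge0 => i _; rewrite le_max lexx. Qed.

Lemma overlap_le p q a b : (forall i, p 0 i <= q 0 i) ->
  overlap p q a b <= box_volume p q.
Proof.
move=> pq; apply: ler_prod => i _; rewrite le_max lexx/=.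
rewrite ge_max subr_ge0 pq/= lerB//; first by rewrite ge_min lexx orbT.
by rewrite le_max lexx orbT.
Qed.

Lemma overlap_sub p q a b : (forall i, a 0 i <= b 0 i) ->
  (forall i, p 0 i <= a 0 i) -> (forall i, b 0 i <= q 0 i) ->
  overlap p q a b = box_volume a b.
Proof.
move=> ab pa bq; apply: eq_bigr => i _.
by rewrite (min_idPl (bq i)) (max_idPl (pa i)) (max_idPr _)// subr_ge0.
Qed.

Lemma overlap_cut p q a b i m : a 0 i <= m -> m <= b 0 i ->
  (forall j, p 0 j <= q 0 j) ->
  overlap p q a (update b i m) + overlap p q (update a i m) b = overlap p q a b.
Proof.
move=> am mb pq; rewrite /overlap.
rewrite (bigD1 i)//= [X in _ + X](bigD1 i)//= [RHS](bigD1 i)//=.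
rewrite !updateE eqxx.
set F := fun j : 'I_d => Num.max 0 (Num.min (b 0 j) (q 0 j) - Num.max (a 0 j) (p 0 j)).
rewrite (eq_bigr F); last by move=> j /negbTE ji; rewrite updateE ji.
rewrite [X in _ + _ * X](eq_bigr F); last first.
  by move=> j /negbTE ji; rewrite updateE ji.
rewrite -mulrDl; congr (_ * _).
have := pq i; move: (p 0 i) (q 0 i) (a 0 i) (b 0 i) am mb => p0 q0 a0 b0 am mb pq0.
case: (leP m q0) => ?; case: (leP b0 q0) => ?; case: (leP a0 p0) => ?;
  case: (leP m p0) => ?; rewrite /Order.max /=; repeat case: ltP => ?; lra.
Qed.

End cutting_boxes.

(** * Boxes have positive outer measure *)

Section boxes_are_not_null.
Context {R : realType} {n : nat}.
Local Notation d := n.+1.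
Implicit Types (a b p q x y : 'rV[R]_d) (A B X : set 'rV[R]_d).

(** The total volume that a family of boxes spends inside the box of corners a
    and b.  It is additive when that box is cut, so if it is smaller than the
    volume of the box, the same holds for one of the two parts. *)
Definition total_overlap (c : nat -> 'rV[R]_d * 'rV[R]_d) a b : \bar R :=
  (\sum_(0 <= k <oo) (overlap (c k).1 (c k).2 a b)%:E)%E.

(** All sides are halved one after the other, each time keeping a half in which
    the total overlap is still smaller than the volume. *)
Lemma halve_box (c : nat -> 'rV[R]_d * 'rV[R]_d) a b :
  (forall k i, (c k).1 0 i <= (c k).2 0 i) -> (forall i, a 0 i <= b 0 i) ->
  (total_overlap c a b < (box_volume a b)%:E)%E ->
  exists ab : 'rV[R]_d * 'rV[R]_d,
    [/\ forall i, a 0 i <= ab.1 0 i, forall i, ab.2 0 i <= b 0 i,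
        forall i, ab.2 0 i - ab.1 0 i = (b 0 i - a 0 i) / 2 &
        (total_overlap c ab.1 ab.2 < (box_volume ab.1 ab.2)%:E)%E].
Proof.
move=> cle ab abc.
suff: forall k, (k <= d)%N -> exists ab : 'rV[R]_d * 'rV[R]_d,
    [/\ forall i, a 0 i <= ab.1 0 i, forall i, ab.2 0 i <= b 0 i,
        forall i : 'I_d, ab.2 0 i - ab.1 0 i =
          if (i < k)%N then (b 0 i - a 0 i) / 2 else b 0 i - a 0 i &
        (total_overlap c ab.1 ab.2 < (box_volume ab.1 ab.2)%:E)%E].
  move=> /(_ d (leqnn d))[ab' [h1 h2 h3 h4]]; exists ab'; split=> // i.
  by rewrite h3 ltn_ord.
elim=> [_|k IH kd]; first by exists (a, b).
have [[a' b'] /= [h1 h2 h3 h4]] := IH (ltnW kd).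
pose i := Ordinal kd; pose m := (a' 0 i + b' 0 i) / 2.
have h3i : b' 0 i - a' 0 i = b 0 i - a 0 i by rewrite h3 /= ltnn.
have am : a' 0 i <= m by have := ab i; rewrite /m; lra.
have mb : m <= b' 0 i by have := ab i; rewrite /m; lra.
have /orP[hlo|hhi] :
  (total_overlap c a' (update b' i m) < (box_volume a' (update b' i m))%:E)%E ||
  (total_overlap c (update a' i m) b' < (box_volume (update a' i m) b')%:E)%E.
- apply: contraLR h4; rewrite negb_or -!leNgt => /andP[lo hi].
  rewrite -(box_volume_cut a' b' i m) EFinD (le_trans (leeD lo hi))//.
  rewrite -nneseriesD/=; last 2 first.
  + by move=> j _ _; rewrite lee_fin overlap_ge0.
  + by move=> j _ _; rewrite lee_fin overlap_ge0.
  by under eq_eseriesr => j _ do rewrite -EFinD (overlap_cut am mb (cle j)).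
- exists (a', update b' i m); split=> //= j; rewrite updateE; case: eqP => [->|/eqP ji] //.
  + by apply: le_trans mb _.
  + by rewrite ltnS leqnn /m; lra.
  + by rewrite h3 ltnS [in RHS]leq_eqVlt -[_ == k]/(j == i) (negbTE ji).
- exists (update a' i m, b'); split=> //= j; rewrite updateE; case: eqP => [->|/eqP ji] //.
  + by apply: le_trans am.
  + by rewrite ltnS leqnn /m; lra.
  + by rewrite h3 ltnS [in RHS]leq_eqVlt -[_ == k]/(j == i) (negbTE ji).
Qed.

Lemma box_volume_double p q :
  box_volume p (q + (q - p)) = 2 ^+ d * box_volume p q.
Proof.
rewrite /box_volume -[X in X ^+ _]/(2%:R : R) -[in X in _ ^+ X](card_ord d) -prodr_const.
by rewrite -big_split/=; apply: eq_bigr => i _; rewrite !mxE; ring.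
Qed.

(** Suppose that the box has a cover of total volume much smaller than its own.
    Doubling the covering boxes at their upper corners multiplies their volumes
    by 2 ^ d and puts every covered point in the interior of some doubled box.
    Repeated halving then gives nested boxes I k, shrinking to a point x, in each
    of which the doubled boxes have total overlap smaller than the volume.  But x
    is interior to one doubled box, which therefore contains I k for large k and
    alone overlaps it in its full volume. *)
Lemma box_not_null a0 b : (forall i, a0 0 i < b 0 i) -> ~ lebesgue_null (box a0 b).
Proof.
move=> a0b null0.
(* The halving starts from an upper sub-box, so that its limit point cannot lie
   on the lower faces, which are not part of the box. *)
pose a : 'rV[R]_d := \row_i ((a0 0 i + b 0 i) / 2).
have a0a i : a0 0 i < a 0 i by rewrite mxE; have := a0b i; lra.
have ab i : a 0 i < b 0 i by rewrite mxE; have := a0b i; lra.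
have V0 : 0 < box_volume a b.
  by apply: prodr_gt0 => i _; rewrite subr_gt0.
have able i : a 0 i <= b 0 i by exact: ltW.
have : (lebesgue_outer (box a0 b) < (box_volume a b / 2 ^+ d)%:E)%E.
  by rewrite null0 lte_fin divr_gt0// exprn_gt0.
move=> /ereal_inf_lt[_ [c [cle abc] <-] csum].
pose c' k := ((c k).1, (c k).2 + ((c k).2 - (c k).1)).
have c'le k i : (c' k).1 0 i <= (c' k).2 0 i.
  by rewrite /= !mxE; have := cle k i; lra.
have small : (total_overlap c' a b < (box_volume a b)%:E)%E.
  apply: (@le_lt_trans _ _ (\sum_(0 <= k <oo)
      ((2 ^+ d)%:E * (box_volume (c k).1 (c k).2)%:E))%E).
    apply: lee_nneseries => k _; first by rewrite lee_fin overlap_ge0.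
    by rewrite -EFinM -box_volume_double lee_fin overlap_le.
  rewrite nneseriesZl; last by move=> k _; rewrite lee_fin box_volume_ge0.
  rewrite -[ltRHS](_ : ((2 ^+ d)%:E * (box_volume a b / 2 ^+ d)%:E)%E = _).
    by rewrite lte_pmul2l// lte_fin exprn_gt0.
  by rewrite -EFinM mulrC divfK// expf_neq0.
pose good (ab : 'rV[R]_d * 'rV[R]_d) :=
  (forall i, ab.1 0 i <= ab.2 0 i) /\
  (total_overlap c' ab.1 ab.2 < (box_volume ab.1 ab.2)%:E)%E.
have /choice[next nextP] : forall ab : 'rV[R]_d * 'rV[R]_d,
    exists ab' : 'rV[R]_d * 'rV[R]_d, good ab ->
    [/\ good ab', forall i, ab.1 0 i <= ab'.1 0 i, forall i, ab'.2 0 i <= ab.2 0 i &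
        forall i, ab'.2 0 i - ab'.1 0 i = (ab.2 0 i - ab.1 0 i) / 2].
  move=> ab'; have [[g1 g2]|ng] := pselect (good ab'); last by exists ab'.
  have [ab'' [h1 h2 h3 h4]] := halve_box c'le g1 g2.
  exists ab'' => _; split=> //; split=> // i.
  by have := h3 i; have := g1 i; lra.
pose I k := iter k next (a, b).
have Igood k : good (I k) by elim: k => [//|k /nextP[]].
have Iw k i : (I k).2 0 i - (I k).1 0 i = (b 0 i - a 0 i) / 2 ^+ k.
  elim: k => [|k IH]; first by rewrite expr0 divr1.
  have [_ _ _ ->] := nextP _ (Igood k).
  by rewrite -/(I k) IH exprS invfM; ring.
have Ilo k m i : (k <= m)%N -> (I k).1 0 i <= (I m).1 0 i.
  move=> /subnK <-; elim: (m - k)%N => [//|j]/le_trans; apply.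
  by have [_ + _ _] := nextP _ (Igood (j + k)%N); exact.
have Ihi k m i : (k <= m)%N -> (I m).2 0 i <= (I k).2 0 i.
  move=> /subnK <-; elim: (m - k)%N => [//|j]; apply: le_trans.
  by have [_ _ + _] := nextP _ (Igood (j + k)%N); exact.
have Ilohi k m i : (I k).1 0 i <= (I m).2 0 i.
  apply: (le_trans (Ilo _ (maxn k m) _ (leq_maxl _ _))).
  apply: (le_trans _ (Ihi _ (maxn k m) _ (leq_maxr _ _))).
  exact: (Igood _).1.
pose x : 'rV[R]_d := \row_i sup [set (I k).1 0 i | k in setT].
have xlo k i : (I k).1 0 i <= x 0 i.
  rewrite mxE; apply: ub_le_sup; last by exists k.
  by exists (b 0 i) => _ [m _ <-]; exact: (Ilohi m 0%N).
have xhi k i : x 0 i <= (I k).2 0 i.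
  rewrite mxE; apply: ge_sup; first by exists ((I 0%N).1 0 i); exists 0%N.
  by move=> _ [m _ <-].
suff [k [m [lo hi]]] : exists k m, (forall i, (c' k).1 0 i <= (I m).1 0 i) /\
    (forall i, (I m).2 0 i <= (c' k).2 0 i).
  have [g1] := Igood m; apply/negP; rewrite -leNgt.
  rewrite -(overlap_sub g1 lo hi).
  rewrite /total_overlap (@nneseriesD1 _ _ k)//.
    by rewrite leeDl// nneseries_ge0// => j _ _; rewrite lee_fin overlap_ge0.
  by move=> j _; rewrite lee_fin overlap_ge0.
clearbody x.
have xbox : box a0 b x.
  move=> i; rewrite in_itv/=; apply/andP; split; last exact: (xhi 0%N).
  exact: lt_le_trans (a0a i) (xlo 0%N i).
have [k _ kx] := abc _ xbox; exists k.
have ck i : (c k).1 0 i < x 0 i <= (c k).2 0 i by have := kx i; rewrite in_itv.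
pose e i := Num.min (x 0 i - (c k).1 0 i) ((c' k).2 0 i - x 0 i).
have e0 i : 0 < e i.
  by rewrite /e lt_min !subr_gt0 /= !mxE; have /andP[] := ck i; lra.
have : \forall m \near \oo, forall i, (b 0 i - a 0 i) / 2 ^+ m < e i.
  apply: filter_forall => i.
  have := @cvg_geometric R (b 0 i - a 0 i) 2^-1.
  rewrite gtr0_norm ?invr_gt0// invf_lt1// ltr1n => /(_ isT) g0.
  have /cvgrPdist_lt /(_ _ (e0 i)) := g0.
  apply: filterS => m; rewrite sub0r normrN /geometric/= exprVn.
  exact: le_lt_trans (ler_norm _).
move=> [m _ /(_ m (leqnn m)) hm]; exists m; split=> i; have := hm i.
  rewrite /e lt_min -Iw => /andP[h _].
  by have := xhi m i; move: h => /=; lra.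
rewrite /e lt_min -Iw => /andP[_ h].
by have := xlo m i; move: h => /=; lra.
Qed.

End boxes_are_not_null.

(** * Rational boxes, measurable sets, and disjoint non-null pieces *)

Section rational_boxes.
Context {R : realType}.

Definition rational_cbox {m : nat} (p : 'rV[rat]_m * 'rV[rat]_m) : set 'rV[R]_m :=
  [set v | forall i, ratr (p.1 0 i) <= v 0 i <= ratr (p.2 0 i)].

Lemma rational_cbox_basis m (v : 'rV[R]_m) (U : set 'rV[R]_m) : nbhs v U ->
  exists p : 'rV[rat]_m * 'rV[rat]_m,
            (forall i, ratr (p.1 0 i) < v 0 i < ratr (p.2 0 i)) /\
            rational_cbox p `<=` U.
Proof.
move=> /nbhs_ballP[e /= e0 eU].
have /choice[p pP] (i : 'I_m) : exists r : rat, v 0 i - e < ratr r < v 0 i.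
  have /rat_in_itvoo[r] : v 0 i - e < v 0 i by rewrite ltrBlDr ltrDl.
  by rewrite in_itv/=; exists r.
have /choice[q qP] (i : 'I_m) : exists r : rat, v 0 i < ratr r < v 0 i + e.
  have /rat_in_itvoo[r] : v 0 i < v 0 i + e by rewrite ltrDl.
  by rewrite in_itv/=; exists r.
exists (\row_i p i, \row_i q i); split=> [i|w wpq].
  by rewrite !mxE; have /andP[_ ->] := pP i; have /andP[-> _] := qP i.
apply: eU; split=> // i j; rewrite ord1 /ball/= ltr_norml.
have := wpq j; rewrite !mxE => /andP[h1 h2].
have /andP[h3 h4] := pP j; have /andP[h5 h6] := qP j.
by apply/andP; split; lra.
Qed.

Lemma rational_cbox_closed m (p : 'rV[rat]_m * 'rV[rat]_m) :
  closed (rational_cbox p).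
Proof.
rewrite (_ : rational_cbox p = \bigcap_i
  ((fun v : 'rV[R]_m => v 0 i) @^-1` `[ratr (p.1 0 i), ratr (p.2 0 i)]%classic)).
  apply: closed_bigI => i _; apply: closed_comp; last exact: itv_closed.
  by move=> v _; exact: coord_continuous.
apply/seteqP; split=> [v pv i _|v pv i] /=; first by rewrite in_itv/=.
by have := pv i I; rewrite /= in_itv/=.
Qed.

Lemma rational_cbox_convex m (p : 'rV[rat]_m * 'rV[rat]_m) :
  convex_set (rational_cbox p).
Proof.
move=> v w t; rewrite !inE => pv pw i.
have -> : (conv t v w : 'rV[R]_m) 0 i = t%:num * v 0 i + (1 - t%:num) * w 0 i.
  by rewrite !mxE.
have t0 : 0 <= t%:num by [].
have t1 : t%:num <= 1 by [].
have /andP[h1 h2] := pv i; have /andP[h3 h4] := pw i.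
by apply/andP; split; nra.
Qed.

End rational_boxes.

Section lebesgue_measurable_sets.
Context {R : realType} {n : nat}.
Local Notation d := n.+1.
Implicit Types (x y : 'rV[R]_d) (A B E G : set 'rV[R]_d).

Lemma lebesgue_measurableC A : lebesgue_measurable A -> lebesgue_measurable (~` A).
Proof. exact: caratheodory_measurable_setC. Qed.

Lemma lebesgue_measurableI A B : lebesgue_measurable A -> lebesgue_measurable B ->
  lebesgue_measurable (A `&` B).
Proof. exact: caratheodory_measurable_setI. Qed.

Lemma lebesgue_measurableU A B : lebesgue_measurable A -> lebesgue_measurable B ->
  lebesgue_measurable (A `|` B).
Proof. exact: caratheodory_measurable_setU. Qed.

Lemma lebesgue_measurableD A B : lebesgue_measurable A -> lebesgue_measurable B ->
  lebesgue_measurable (A `\` B).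
Proof. exact: caratheodory_measurable_setD. Qed.

Lemma lebesgue_measurable0 : lebesgue_measurable (set0 : set 'rV[R]_d).
Proof. exact: caratheodory_measurable_set0. Qed.

Lemma lebesgue_measurable_bigcup (I : countType) (P : set I)
    (F : I -> set 'rV[R]_d) :
  (forall i, P i -> lebesgue_measurable (F i)) ->
  lebesgue_measurable (\bigcup_(i in P) F i).
Proof.
move=> mF; pose M k :=
  if unpickle k is Some i then (if `[< P i >] then F i else set0) else set0.
have -> : \bigcup_(i in P) F i = \bigcup_k M k.
  apply/seteqP; split=> [x [i Pi Fix]|x [k _]].
    by exists (pickle i) => //; rewrite /M pickleK; case: asboolP.
  by rewrite /M; case: unpickle => [i|//]; case: asboolP => // Pi Fi; exists i.
apply: caratheodory_measurable_bigcup => k; rewrite /M.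
case: unpickle => [i|]; last exact: lebesgue_measurable0.
by case: asboolP => [/mF//|_]; exact: lebesgue_measurable0.
Qed.

Lemma lebesgue_measurable_bigcap (I : countType) (P : set I)
    (F : I -> set 'rV[R]_d) :
  (forall i, P i -> lebesgue_measurable (F i)) ->
  lebesgue_measurable (\bigcap_(i in P) F i).
Proof.
move=> mF; rewrite -[X in lebesgue_measurable X]setCK setC_bigcap.
apply/lebesgue_measurableC/lebesgue_measurable_bigcup => i Pi.
exact/lebesgue_measurableC/mF.
Qed.

Lemma box_measurable (a b : 'rV[R]_d) : lebesgue_measurable (box a b).
Proof.
rewrite (_ : box a b = \bigcap_(i in [set: 'I_d])
    ([set y : 'rV[R]_d | y 0 i <= b 0 i] `\` [set y | y 0 i <= a 0 i])).
  apply: lebesgue_measurable_bigcap => i _.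
  by apply: lebesgue_measurableD; exact: halfspace_measurable.
apply/seteqP; split=> [y aby i _|y aby i].
  by have := aby i; rewrite in_itv/= => /andP[h1 h2]; split => //=; rewrite leNgt h1.
by have [/= h1 /negP] := aby i I; rewrite -ltNge => h2; rewrite in_itv/= h2.
Qed.

(** An open set is the countable union of the half-open rational boxes that it
    contains. *)
Lemma open_lebesgue_measurable A : open A -> lebesgue_measurable A.
Proof.
move=> oA; pose rbox (p : 'rV[rat]_d * 'rV[rat]_d) : set 'rV[R]_d :=
  box (map_mx ratr p.1) (map_mx ratr p.2).
have rboxS p : rbox p `<=` rational_cbox p.
  move=> y py i; have := py i.
  by rewrite in_itv/= !mxE => /andP[/ltW -> ->].
rewrite (_ : A = \bigcup_(p in [set p | rbox p `<=` A]) rbox p).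
  by apply: lebesgue_measurable_bigcup => p _; exact: box_measurable.
apply/seteqP; split=> [x Ax|x [p]]; last exact.
have [p [px pA]] := rational_cbox_basis (open_nbhs_nbhs (conj oA Ax)).
exists p; first exact: subset_trans (rboxS p) pA.
move=> i; rewrite in_itv/= !mxE.
by have /andP[-> /ltW ->] := px i.
Qed.

Lemma closed_lebesgue_measurable A : closed A -> lebesgue_measurable A.
Proof.
move=> cA; rewrite -[A]setCK; apply/lebesgue_measurableC.
exact/open_lebesgue_measurable/closed_openC.
Qed.

(** Countably many boxes of volume at most e cover the space, so the traces of E
    on them cannot all be null. *)
Lemma small_piece E (e : R) : lebesgue_measurable E -> ~ lebesgue_null E -> 0 < e ->
  exists G, [/\ G `<=` E, lebesgue_measurable G, ~ lebesgue_null G &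
                (lebesgue_outer G <= e%:E)%E].
Proof.
move=> mE nE e0; apply: contrapT => noG; apply: nE.
apply: (@lebesgue_nullS _ _ _ (\bigcup_(p in [set p : 'rV[rat]_d * 'rV[rat]_d |
    (lebesgue_outer (rational_cbox p : set 'rV[R]_d) <= e%:E)%E])
    (E `&` rational_cbox p))); last first.
  apply: lebesgue_null_bigcup_count => p /= pe; apply: contrapT => nG; apply: noG.
  exists (E `&` rational_cbox p); split=> //.
    apply: lebesgue_measurableI => //.
    exact/closed_lebesgue_measurable/rational_cbox_closed.
  exact: le_trans (le_lebesgue_outer _) pe.
move=> y Ey; pose r := Num.min e 1 / 2.
have r0 : 0 < r by rewrite divr_gt0// lt_min e0 ltr01.
have [p [py pr]] := rational_cbox_basis (nbhsx_ballx y r r0).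
exists p; last by split=> // i; have /andP[/ltW -> /ltW ->] := py i.
pose a : 'rV[R]_d := \row_i (y 0 i - r); pose b : 'rV[R]_d := \row_i (y 0 i + r).
have ab i : a 0 i <= b 0 i by rewrite !mxE; lra.
apply: (@le_trans _ _ (lebesgue_outer (box a b))).
  apply: le_lebesgue_outer => z /pr[_ yz] i.
  have := yz 0 i; rewrite /ball/= ltr_norml in_itv/= !mxE => /andP[h1 h2].
  by apply/andP; split; lra.
apply: (le_trans (lebesgue_outer_box_le ab)); rewrite lee_fin.
rewrite /box_volume (eq_bigr (fun=> Num.min e 1)); last first.
  by move=> i _; rewrite !mxE /r; lra.
rewrite prodr_const card_ord exprS (@le_trans _ _ (Num.min e 1 * 1))//.
  have m0 : 0 <= Num.min e 1 by rewrite le_min (ltW e0) ler01.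
  by rewrite ler_wpM2l// exprn_ile1// ge_min lexx orbT.
by rewrite mulr1 ge_min lexx.
Qed.

(** Choose G k inside E k so small that the pieces G (k + 1), G (k + 2), ...
    together have outer measure less than that of G k, and remove these later
    pieces from G k: what is left cannot be null by subadditivity. *)
Lemma disjoint_pieces (E : nat -> set 'rV[R]_d) :
  (forall k, lebesgue_measurable (E k)) ->
  exists F : nat -> set 'rV[R]_d,
    [/\ forall k, F k `<=` E k, forall k, lebesgue_measurable (F k),
        forall j k, j != k -> F j `&` F k = set0 &
        forall k, ~ lebesgue_null (E k) -> ~ lebesgue_null (F k)].
Proof.
move=> mE.
(* The second component of ke bounds the outer measure of the next piece; the
   new bound is at most half of it and a quarter of the measure of the piece. *)
have /choice[step stepP] : forall ke : nat * {posnum R},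
    exists Ge : set 'rV[R]_d * {posnum R},
    [/\ Ge.1 `<=` E ke.1, lebesgue_measurable Ge.1,
        (lebesgue_outer Ge.1 <= (ke.2%:num)%:E)%E, Ge.2%:num <= ke.2%:num / 2 &
        ~ lebesgue_null (E ke.1) ->
          ((Ge.2%:num * 4)%:E <= lebesgue_outer Ge.1)%E /\ ~ lebesgue_null Ge.1].
  move=> [k e] /=; have [nE|pE] := pselect (lebesgue_null (E k)).
    exists (set0, (e%:num / 2)%:pos); split => //=.
    - exact: lebesgue_measurable0.
    - by rewrite lebesgue_outer0 lee_fin.
  have [G [GE mG nG Ge]] := small_piece (mE k) pE [gt0 of e%:num].
  have Gfin : lebesgue_outer G \is a fin_num.
    by rewrite ge0_fin_numE ?lebesgue_outer_ge0// (le_lt_trans Ge)// ltry.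
  have G0 : 0 < fine (lebesgue_outer G).
    rewrite lt_neqAle fine_ge0 ?lebesgue_outer_ge0// andbT.
    apply/eqP => G0; apply: nG; rewrite /lebesgue_null -(fineK Gfin).
    by rewrite -G0.
  have GE4 : (lebesgue_outer G = (fine (lebesgue_outer G))%:E)%E by rewrite fineK.
  have e'0 : 0 < fine (lebesgue_outer G) / 4 by rewrite divr_gt0.
  exists (G, PosNum e'0); split=> //=.
    by move: Ge; rewrite GE4 lee_fin; lra.
  by split=> //; rewrite GE4 lee_fin; lra.
pose S : nat -> set 'rV[R]_d * {posnum R} :=
  fix S k := if k is k'.+1 then step (k, (S k').2) else step (0%N, PosNum ltr01).
pose G k := (S k).1; pose e k := (S k).2%:num.
have /choice[q Sq] k : exists q, S k = step (k, q).
  by case: k => [|k] /=; eexists.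
have GE k : G k `<=` E k by rewrite /G Sq; have [] := stepP (k, q k).
have mG k : lebesgue_measurable (G k) by rewrite /G Sq; have [] := stepP (k, q k).
have Ge k : (lebesgue_outer (G k.+1) <= (e k)%:E)%E.
  by have [] := stepP (k.+1, (S k).2).
have ee k j : e (k + j)%N <= e k / 2 ^+ j.
  elim: j => [|j IH]; first by rewrite addn0 expr0 divr1.
  have [_ _ _ h _] := stepP ((k + j).+1, (S (k + j)%N).2).
  by rewrite addnS exprSr invfM mulrA (le_trans h)// ler_wpM2r.
have nG k : ~ lebesgue_null (E k) -> ((e k * 4)%:E <= lebesgue_outer (G k))%E.
  by move=> nE; rewrite /e /G Sq; have [_ _ _ _ /(_ nE)[]] := stepP (k, q k).
pose F k := G k `\` \bigcup_j G (k.+1 + j)%N.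
exists F; split.
- by move=> k x [/GE].
- move=> k; apply: lebesgue_measurableD => //.
  by apply: lebesgue_measurable_bigcup => j _.
- suff lt_disj j k : (j < k)%N -> F j `&` F k = set0.
    move=> j k; rewrite neq_ltn => /orP[|/lt_disj] //; first exact: lt_disj.
    by rewrite setIC.
  move=> jk; apply/seteqP; split=> // x [[_ nx] [Gkx _]]; apply: nx.
  by exists (k - j.+1)%N => //; rewrite subnKC.
move=> k /nG Gk Fk.
have : (lebesgue_outer (G k) <= (2 * e k)%:E)%E.
  apply: (@le_trans _ _ (lebesgue_outer (F k `|` \bigcup_j G (k.+1 + j)%N))).
    apply: le_lebesgue_outer => x Gx.
    have [|] := pselect ((\bigcup_j G (k.+1 + j)%N) x); first by right.
    by left.
  apply: (le_trans (outer_measureU2 _ _ _)); rewrite /= Fk add0e.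
  apply: (le_trans (lebesgue_outer_sigma_subadditive _)).
  apply: (@le_trans _ _ (\sum_(0 <= j <oo) ((2 * e k) / (2 ^ j.+1)%:R)%:E)%E).
    apply: lee_nneseries => [j _ _|j _]; first exact: lebesgue_outer_ge0.
    rewrite addSn (le_trans (Ge _))// lee_fin (le_trans (ee _ _))//.
    by rewrite natrX exprS invfM mulrACA divff// mul1r.
  have ek0 : 0 <= 2 * e k by rewrite /e mulr_ge0.
  exact: (epsilon_trick0 xpredT ek0).
move=> /(le_trans Gk); rewrite lee_fin.
by have : 0 < (S k).2%:num by []; rewrite -/(e k); lra.
Qed.

End lebesgue_measurable_sets.

(** * Null sets and the map m for arbitrary set-valued maps *)

Section convex_hulls.
Context {R : realType} {l : nat}.
Implicit Types (A B C : set 'rV[R]_l).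

Lemma closed_convex_hull_closed A : closed (closed_convex_hull A).
Proof. by apply: closed_bigI => C [[]]. Qed.

Lemma closed_convex_hull_convex A : convex_set (closed_convex_hull A).
Proof.
move=> v w t; rewrite !inE => Av Aw C CA.
have [[_ cC] _] := CA.
by apply: set_mem; apply: cC; rewrite inE; [exact: Av|exact: Aw].
Qed.

Lemma sub_closed_convex_hull A : A `<=` closed_convex_hull A.
Proof. exact: sub_smallest. Qed.

Lemma closed_convex_hull_min A C : closed C -> convex_set C -> A `<=` C ->
  closed_convex_hull A `<=` C.
Proof. by move=> cC vC AC; exact: smallest_sub. Qed.

Lemma closed_convex_hull_sub A B : A `<=` closed_convex_hull B ->
  closed_convex_hull A `<=` closed_convex_hull B.
Proof.
apply: closed_convex_hull_min; [exact: closed_convex_hull_closed|].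
exact: closed_convex_hull_convex.
Qed.

Lemma closed_convex_hullS A B : A `<=` B ->
  closed_convex_hull A `<=` closed_convex_hull B.
Proof.
move=> AB; apply: closed_convex_hull_sub.
by apply: subset_trans AB _; exact: sub_closed_convex_hull.
Qed.

Lemma convE (t : {i01 R}) (v w : 'rV[R]_l) :
  conv t (v : convex_lmodType 'rV[R]_l) w = t%:num *: v + (1 - t%:num) *: w.
Proof. by []. Qed.

Lemma norm_ball_convex (M : R) : convex_set [set v : 'rV[R]_l | `|v| <= M].
Proof.
move=> v w t; rewrite !inE /= convE => vM wM.
have t0 : 0 <= t%:num by [].
have t1 : 0 <= 1 - t%:num by rewrite subr_ge0.
rewrite (le_trans (ler_normD _ _))// !normrZ (ger0_norm t0) (ger0_norm t1).
by rewrite (@le_trans _ _ (t%:num * M + (1 - t%:num) * M)) ?lerD ?ler_wpM2l//; lra.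
Qed.

Lemma norm_ball_compact (M : R) : compact [set v : 'rV[R]_l | `|v| <= M].
Proof.
apply: bounded_closed_compact.
  exists M; split; first exact: num_real.
  by move=> M' MM' v /= /le_trans; apply; exact: ltW.
rewrite (_ : mkset _ = Num.norm @^-1` [set r : R | r <= M]) //.
apply: closed_comp; last exact: closed_le.
by move=> v _; exact: norm_continuous.
Qed.

End convex_hulls.

Section euclidean_balls.
Context {R : realType} {d : nat}.
Implicit Types (x y : 'rV[R]_d).

Lemma euclidean_ball_center x (delta : R) : 0 < delta -> euclidean_ball x delta x.
Proof.
move=> d0; rewrite /euclidean_ball /= big1 ?sqrtr0// => i _.
by rewrite subrr expr0n.
Qed.

Lemma sqr_dist_continuous x :
  continuous (fun y : 'rV[R]_d => \sum_(i < d) (y 0 i - x 0 i) ^+ 2).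
Proof.
apply: continuous_big => [|i _ y]; first exact: add_continuous.
apply: (@continuous_comp _ _ _ (fun y : 'rV[R]_d => y 0 i - x 0 i) (fun r => r ^+ 2)).
  have coord : {for y, continuous (fun y : 'rV[R]_d => y 0 i)} by exact: coord_continuous.
  exact: (cvgB coord (@cvg_cst _ _ _ _ _)).
exact: exprn_continuous.
Qed.

Lemma euclidean_ball_open x (delta : R) : open (euclidean_ball x delta).
Proof.
pose g (y : 'rV[R]_d) : R := Num.sqrt (\sum_(i < d) (y 0 i - x 0 i) ^+ 2).
rewrite (_ : euclidean_ball x delta = g @^-1` [set r | r < delta])//.
apply: open_comp; last exact: open_lt.
move=> y _; apply: continuous_comp; first exact: sqr_dist_continuous.
exact: sqrt_continuous.
Qed.

Lemma euclidean_ball_nbhs x (delta : R) : 0 < delta -> nbhs x (euclidean_ball x delta).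
Proof.
move=> d0; apply: open_nbhs_nbhs; split; first exact: euclidean_ball_open.
exact: euclidean_ball_center.
Qed.

Lemma nbhs_euclidean_ball x (U : set 'rV[R]_d) : nbhs x U ->
  exists2 delta : R, 0 < delta & euclidean_ball x delta `<=` U.
Proof.
move=> /nbhs_ballP[e /= e0 eU]; exists e => // y xy; apply: eU; split=> // i j.
rewrite ord1 /ball/= distrC -sqrtr_sqr; apply: le_lt_trans xy.
rewrite ler_sqrt; last by apply: sumr_ge0 => k _; exact: sqr_ge0.
by rewrite (bigD1 j)//= lerDl; apply: sumr_ge0 => k _; exact: sqr_ge0.
Qed.

End euclidean_balls.

Section the_map_m.
Context {R : realType} {n l : nat}.
Local Notation d := n.+1.
Implicit Types (Phi Psi G H : 'rV[R]_d -> set 'rV[R]_l) (x y : 'rV[R]_d)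
  (p : 'rV[rat]_d * 'rV[rat]_d) (q : 'rV[rat]_l * 'rV[rat]_l).

Lemma euclidean_ball_not_null x (delta : R) : 0 < delta ->
  ~ lebesgue_null (euclidean_ball x delta).
Proof.
move=> d0 null_ball.
have [p [xp pd]] := rational_cbox_basis (euclidean_ball_nbhs x d0).
apply: (@box_not_null R n (map_mx ratr p.1) (map_mx ratr p.2)).
  by move=> i; rewrite !mxE; have /andP[] := xp i; exact: lt_trans.
apply: lebesgue_nullS null_ball => y py; apply: pd => i; have := py i.
by rewrite in_itv/= !mxE => /andP[/ltW -> ->].
Qed.

Definition essential_hull Phi x (N : set 'rV[R]_d) (delta : R) : set 'rV[R]_l :=
  closed_convex_hull (\bigcup_(y in euclidean_ball x delta `\` N) Phi y).

Lemma m_mapP Phi x v : m_map Phi x v <->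
  forall N delta, lebesgue_null N -> 0 < delta -> essential_hull Phi x N delta v.
Proof. by split=> [h N delta N0 d0|h N N0 delta d0]; apply: h. Qed.

Lemma not_m_map Phi x v : ~ m_map Phi x v ->
  exists N (delta : R), [/\ lebesgue_null N, 0 < delta &
                            ~ essential_hull Phi x N delta v].
Proof.
move=> h; apply: contrapT => hn; apply: h; apply/m_mapP => N delta N0 d0.
by apply: contrapT => hv; apply: hn; exists N, delta.
Qed.

(** Together, the rational boxes p and q quantify over countably many tests,
    which is what makes exceptional sets null. *)
Definition hits Phi p q : set 'rV[R]_d :=
  [set y | rational_cbox p y /\ Phi y `&` rational_cbox q !=set0].

(** A value w outside the closed hull has a rational neighbourhood q missing the
    hull; near y, the map can then reach q only at points of N. *)
Lemma hits_null Phi x N (delta : R) y w : lebesgue_null N ->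
  euclidean_ball x delta y -> ~ essential_hull Phi x N delta w ->
  exists p q, [/\ rational_cbox p y, rational_cbox q w & lebesgue_null (hits Phi p q)].
Proof.
move=> N0 xy nw.
have [q [qw qN]] := rational_cbox_basis (open_nbhs_nbhs
  (conj (closed_openC (@closed_convex_hull_closed R l _)) nw)).
have [p [py pd]] := rational_cbox_basis
  (open_nbhs_nbhs (conj (@euclidean_ball_open R d x delta) xy)).
exists p, q; split.
- by move=> i; have /andP[/ltW -> /ltW ->] := py i.
- by move=> i; have /andP[/ltW -> /ltW ->] := qw i.
apply: lebesgue_nullS N0 => z [pz [u [Gu qu]]]; apply: contrapT => Nz.
apply: (qN _ qu); apply: sub_closed_convex_hull; exists z => //.
by split=> //; exact: pd.
Qed.

(** The null sets among hits G p q are removed from the ball that defines m(G).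
    At the remaining points the values of G lie in any given hull for H, since a
    value outside would produce a null hits H p q. *)
Lemma m_map_le_hits G H :
  (forall p q, lebesgue_null (hits H p q) -> lebesgue_null (hits G p q)) ->
  map_le (m_map G) (m_map H).
Proof.
move=> HG x v Gv; apply/m_mapP => N delta N0 d0.
pose N' := \bigcup_(pq in [set pq | lebesgue_null (hits G pq.1 pq.2)]) hits G pq.1 pq.2.
have N'0 : lebesgue_null N' by exact: lebesgue_null_bigcup_count.
have /m_mapP/(_ N' delta N'0 d0) := Gv; apply: closed_convex_hull_sub.
move=> w [y [xy N'y] Gw]; apply: contrapT => nw; apply: N'y.
have [p [q [py qw /HG pq]]] := hits_null N0 xy nw.
by exists (p, q) => //; split=> //; exists w.
Qed.

Lemma ae_sub_m_map G : lebesgue_null [set x | ~ (G x `<=` m_map G x)].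
Proof.
pose N' := \bigcup_(pq in [set pq | lebesgue_null (hits G pq.1 pq.2)]) hits G pq.1 pq.2.
apply: (@lebesgue_nullS _ _ _ N'); last exact: lebesgue_null_bigcup_count.
move=> x /= /existsNP[v /not_implyP[Gv /not_m_map[N [delta [N0 d0 nv]]]]].
have [p [q [py qw pq]]] := hits_null N0 (euclidean_ball_center x d0) nv.
by exists (p, q) => //; split=> //; exists v.
Qed.

Lemma m_map_le_ae G H : lebesgue_null [set x | ~ (G x `<=` H x)] ->
  map_le (m_map G) (m_map H).
Proof.
move=> GH0; apply: m_map_le_hits => p q pq0.
apply: lebesgue_nullS (lebesgue_nullU GH0 pq0) => y [py [w [Gw qw]]].
have [GH|] := pselect (G y `<=` H y); last by left.
by right; split=> //; exists w; split=> //; exact: GH.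
Qed.

End the_map_m.

(** * The map m on cusco maps *)

Section m_of_a_cusco_map.
Context {R : realType} {n l : nat}.
Local Notation d := n.+1.
Implicit Types (Phi Psi : 'rV[R]_d -> set 'rV[R]_l) (x y : 'rV[R]_d).

(** Near x the values of Phi stay in the closed e / 2-neighbourhood W of Phi x,
    which is closed and convex and so contains the hulls as well. *)
Lemma m_map_le_cusco Phi : cusco Phi -> map_le (m_map Phi) Phi.
Proof.
move=> [usc cc] x v mv; have [_ cPhi vPhi] := cc x.
have clPhi : closed (Phi x) by apply: compact_closed => //; exact: norm_hausdorff.
suff : closure (Phi x) v by rewrite -(closure_id _).1.
move=> U /nbhs_ballP[e /= e0 eU].
pose W := [set w : 'rV[R]_l | exists2 u, Phi x u & `|w - u| <= e / 2].
have e20 : 0 < e / 2 by rewrite divr_gt0.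
have cW : closed W.
  apply: compact_closed; first exact: norm_hausdorff.
  rewrite (_ : W = (fun z : 'rV[R]_l * 'rV[R]_l => z.1 + z.2) @`
      (Phi x `*` [set w | `|w| <= e / 2])).
    apply: continuous_compact.
      by apply: continuous_subspaceT => z; exact: add_continuous.
    by apply: compact_setX => //; exact: norm_ball_compact.
  apply/seteqP; split=> [w [u xu wu]|_ [[u w] /= [xu we] <-]].
    by exists (u, w - u) => //=; rewrite addrC subrK.
  by exists u => //; rewrite addrC addKr.
have vW : convex_set W.
  move=> w1 w2 t; rewrite !inE => -[u1 xu1 h1] [u2 xu2 h2].
  exists (conv t (u1 : convex_lmodType 'rV[R]_l) u2).
    by apply: set_mem; apply: vPhi; rewrite inE.
  have := @norm_ball_convex R l (e / 2) (w1 - u1) (w2 - u2) t.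
  rewrite !inE => /(_ h1 h2) /=; rewrite !convE; congr (`|_| <= _).
  by rewrite !scalerBr opprD !addrA; congr (_ - _); rewrite addrAC.
have [delta d0 dW] : exists2 delta : R, 0 < delta &
    euclidean_ball x delta `<=` [set y | Phi y `<=` W].
  pose V := \bigcup_(u in Phi x) ball u (e / 2).
  have oV : open V by apply: bigcup_open => u _; exact: ball_open.
  have PhiV : Phi x `<=` V by move=> u xu; exists u => //; exact: ballxx.
  have [delta d0 dV] := nbhs_euclidean_ball (usc x V oV PhiV).
  exists delta => // y /dV yV; apply: subset_trans yV _ => w [u xu].
  by rewrite -ball_normE/= distrC => /ltW h; exists u.
have [u xu vu] : W v.
  move/m_mapP : mv => /(_ set0 delta lebesgue_null0 d0).
  apply: closed_convex_hull_min => // w [y [xy _] yw].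
  exact: dW xy _ yw.
exists u; split=> //; apply: eU; rewrite -ball_normE/=.
by rewrite (le_lt_trans vu)// ltr_pdivrMr// ltr_pMr// ltr1n.
Qed.

Lemma cusco_locally_bounded Phi x : cusco Phi ->
  exists (delta M : R), 0 < delta /\
    forall y, euclidean_ball x delta y -> Phi y `<=` [set v | `|v| <= M].
Proof.
move=> [usc cc]; have [_ cPhi _] := cc x.
have [M [_ MP]] := compact_bounded cPhi.
pose V := ball (0 : 'rV[R]_l) (M + 2).
have PhiV : Phi x `<=` V.
  move=> v xv; rewrite /V -ball_normE/= sub0r normrN.
  have M1 : M < M + 1 by rewrite ltrDl.
  by apply: le_lt_trans (MP _ M1 v xv) _; lra.
have [delta d0 dV] := nbhs_euclidean_ball (usc x V (ball_open _ _) PhiV).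
exists delta, (M + 2); split=> // y /dV yV v /yV.
by rewrite /V -ball_normE/= sub0r normrN => /ltW.
Qed.

Lemma essential_hullS Phi x y N N' (delta delta' : R) :
  euclidean_ball x delta `\` N `<=` euclidean_ball y delta' `\` N' ->
  essential_hull Phi x N delta `<=` essential_hull Phi y N' delta'.
Proof.
move=> h; apply: closed_convex_hullS => v [z /h xz zv]; by exists z.
Qed.

(** The hulls form a directed family, eventually inside a compact set, and
    m(Phi)(x) is their intersection.  If each met the complement of V, the filter
    they generate there would cluster at a point of m(Phi)(x) outside V. *)
Lemma m_map_sub_open Phi x (V : set 'rV[R]_l) : cusco Phi -> open V ->
  m_map Phi x `<=` V ->
  exists N (delta : R), [/\ lebesgue_null N, 0 < delta &
                            essential_hull Phi x N delta `<=` V].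
Proof.
move=> cPhi oV mV; apply: contrapT => noV.
have [delta0 [M [d00 dM]]] := cusco_locally_bounded x cPhi.
pose D := [set Nd : set 'rV[R]_d * R | lebesgue_null Nd.1 /\ 0 < Nd.2].
pose F := filter_from D (fun Nd => essential_hull Phi x Nd.1 Nd.2 `\` V).
have FF : ProperFilter F.
  apply: filter_from_proper; last first.
    move=> [N delta] [/= N0 d0]; apply/set0P/eqP => h0; apply: noV.
    exists N, delta; split=> // v hv; apply: contrapT => nv.
    by have : (essential_hull Phi x N delta `\` V) v by []; rewrite h0.
  apply: filter_from_filter.
    by exists (set0, 1); split => //=; exact: lebesgue_null0.
  move=> [N delta] [N' delta'] [/= N0 d0] [/= N0' d0'].
  exists (N `|` N', Num.min delta delta') => /=.
    by split=> /=; [exact: lebesgue_nullU|rewrite lt_min d0].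
  move=> v [hv nv]; split; split=> //; move: hv; apply: essential_hullS => y [yd nN].
    split; last by move=> Ny; apply: nN; left.
    by apply: lt_le_trans yd _; rewrite ge_min lexx.
  split; last by move=> Ny; apply: nN; right.
  by apply: lt_le_trans yd _; rewrite ge_min lexx orbT.
have cK : compact ([set v : 'rV[R]_l | `|v| <= M] `\` V).
  rewrite setDE; apply: compact_closedI; first exact: norm_ball_compact.
  exact: open_closedC.
have [|v [[vM nVv] clv]] := cK F FF.
  exists (set0, delta0); first by split => //=; exact: lebesgue_null0.
  move=> v [/= hv nv]; split=> //; move: v hv {nv}.
  apply: closed_convex_hull_min.
  - by apply: compact_closed; [exact: norm_hausdorff|exact: norm_ball_compact].
  - exact: norm_ball_convex.
  - by move=> v [y [xy _]]; exact: dM.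
apply: nVv; apply: mV; apply/m_mapP => N delta N0 d0.
apply: (@closed_convex_hull_closed R l _ v) => U vU.
have FN : F (essential_hull Phi x N delta).
  by exists (N, delta) => // w [].
exact: clv FN vU.
Qed.

(** Upper semicontinuity is m_map_sub_open transported to nearby points.  For
    nonemptiness, V is the empty set: a hull contained in it would force a ball
    to be null. *)
Lemma m_map_cusco Phi : cusco Phi -> cusco (m_map Phi).
Proof.
move=> cPhi; split=> [x V oV mV|x].
  have [N [delta [N0 d0 hV]]] := m_map_sub_open cPhi oV mV.
  apply: filterS (euclidean_ball_nbhs x d0) => y xy.
  have [delta' d0' yx] := nbhs_euclidean_ball (open_nbhs_nbhs
    (conj (@euclidean_ball_open R d x delta) xy)).
  move=> v /m_mapP/(_ N delta' N0 d0') hv; apply: hV.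
  by apply: essential_hullS hv => z [/yx].
have clm : closed (m_map Phi x).
  by do 2 apply: closed_bigI => ? _; exact: closed_convex_hull_closed.
split.
- apply/set0P/eqP => m0.
  have [|N [delta [N0 d0 hV]]] := m_map_sub_open cPhi open0 (x := x).
    by rewrite m0.
  apply: (euclidean_ball_not_null d0 (x := x)).
  apply: lebesgue_nullS N0 => y xy; apply: contrapT => Ny.
  have [[v yv] _ _] := cPhi.2 y.
  by apply: (hV v); apply: sub_closed_convex_hull; exists y.
- have [_ cx _] := cPhi.2 x.
  by apply: subclosed_compact clm cx _; exact: m_map_le_cusco.
- move=> v w t; rewrite !inE => mv mw N N0 delta d0.
  apply: set_mem; apply: closed_convex_hull_convex; rewrite inE.
    exact: mv.
  exact: mw.
Qed.

Lemma m_map_ae_equal Phi : cusco Phi -> ae_equal (m_map Phi) Phi.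
Proof.
move=> cPhi; apply: lebesgue_nullS (ae_sub_m_map Phi) => x /= neq sub.
by apply: neq; apply/seteqP; split=> //; exact: m_map_le_cusco.
Qed.

End m_of_a_cusco_map.

(** * Measurable selections and the theorem *)

Section measurable_selections.
Context {R : realType} {n l : nat}.
Local Notation d := n.+1.
Implicit Types (Phi Psi : 'rV[R]_d -> set 'rV[R]_l) (x y : 'rV[R]_d).

(** The difference with 0 makes this the function whose continuity is given by
    sqr_dist_continuous. *)
Definition sqr_norm (v : 'rV[R]_l) : R :=
  \sum_(i < l) (v 0 i - (0 : 'rV[R]_l) 0 i) ^+ 2.

Lemma sqr_norm_argmin (A : set 'rV[R]_l) : A !=set0 -> compact A ->
  exists2 v, A v & forall w, A w -> sqr_norm v <= sqr_norm w.
Proof.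
move=> A0 cA.
have cN : {within A, continuous sqr_norm}.
  by apply: continuous_subspaceT => v; exact: sqr_dist_continuous.
have [v /set_mem Av vmin] := compact_EVT_min A0 cA cN.
by exists v => // w Aw; apply: vmin; rewrite inE.
Qed.

(** Strict convexity, through the parallelogram identity at the midpoint. *)
Lemma sqr_norm_argmin_unique (A : set 'rV[R]_l) v w : convex_set A ->
  A v -> A w -> (forall u, A u -> sqr_norm v <= sqr_norm u) ->
  sqr_norm w <= sqr_norm v -> v = w.
Proof.
move=> cA Av Aw vmin wv.
pose u : 'rV[R]_l := 2^-1 *: (v + w).
have Au : A u.
  have half01 : 0 <= (2^-1 : R) <= 1 by apply/andP; split; lra.
  have := cA v w (Itv01 (andP half01).1 (andP half01).2).
  rewrite !inE => /(_ Av Aw); rewrite convE/=.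
  have -> : 1 - 2^-1 = 2^-1 :> R by lra.
  by rewrite -scalerDr.
have dist : \sum_(i < l) (v 0 i - w 0 i) ^+ 2 <= 0.
  have : \sum_(i < l) (v 0 i - w 0 i) ^+ 2 =
      2 * sqr_norm v + 2 * sqr_norm w - 4 * sqr_norm u.
    rewrite /sqr_norm !mulr_sumr -big_split -sumrB/=.
    by apply: eq_bigr => i _; rewrite !mxE; field.
  by move=> ->; have := vmin _ Au; lra.
apply/rowP => i; apply/eqP; rewrite -subr_eq0 -sqrf_eq0.
apply/eqP/le_anti; rewrite sqr_ge0 andbT (le_trans _ dist)//.
by rewrite (bigD1 i)//= lerDl sumr_ge0// => j _; exact: sqr_ge0.
Qed.

(** Take for f y the point of least Euclidean norm of Psi y.  It lies in a closed
    set K exactly when Psi y meets K and, for every rational q, Psi y meets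
    K within the ball sqr_norm <= q whenever it meets that ball: the minimum over
    the intersection with K is then the minimum over Psi y. *)
Lemma measurable_selection Psi :
  (forall y, [/\ Psi y !=set0, compact (Psi y) & convex_set (Psi y)]) ->
  (forall K, closed K -> lebesgue_measurable [set y | Psi y `&` K !=set0]) ->
  exists f, lebesgue_measurable_fun f /\ forall y, Psi y (f y).
Proof.
move=> PsiP mPsi.
have /choice[f fP] y : exists v, Psi y v /\ forall w, Psi y w -> sqr_norm v <= sqr_norm w.
  have [Psi0 cPsi _] := PsiP y.
  by have [v yv vmin] := sqr_norm_argmin Psi0 cPsi; exists v.
exists f; split=> [U oU|y]; last by have [] := fP y.
pose K := ~` U; have cK : closed K by exact: open_closedC.
pose S (q : rat) := [set v : 'rV[R]_l | sqr_norm v <= ratr q].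
have cS q : closed (S q).
  rewrite (_ : S q = sqr_norm @^-1` [set r | r <= ratr q])//.
  apply: closed_comp; last exact: closed_le.
  by move=> v _; exact: sqr_dist_continuous.
rewrite (_ : f @^-1` U = ~` ([set y | Psi y `&` K !=set0] `&`
   \bigcap_(q in [set: rat]) (~` [set y | Psi y `&` S q !=set0] `|`
                [set y | Psi y `&` (K `&` S q) !=set0]))).
  apply/lebesgue_measurableC/lebesgue_measurableI; first exact: mPsi.
  apply: lebesgue_measurable_bigcap => q _; apply: lebesgue_measurableU.
    by apply: lebesgue_measurableC; exact: mPsi.
  by apply: mPsi; exact: closedI.
rewrite -[LHS]setCK preimage_setC; congr (~` _).
apply/seteqP; split=> y.
  rewrite -/K /= => Kfy; have [fy fmin] := fP y.
  split; first by exists (f y).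
  move=> q _; have [[w [yw wq]]|] := pselect (Psi y `&` S q !=set0); last by left.
  right; exists (f y); split=> //; split=> //.
  exact: le_trans (fmin _ yw) wq.
move=> [K0 hq]; have [fy fmin] := fP y; have [_ cPsi vPsi] := PsiP y.
have [w [yw Kw] wmin] := sqr_norm_argmin K0 (compact_closedI cPsi cK).
suff wf : sqr_norm w <= sqr_norm (f y).
  by rewrite /= (sqr_norm_argmin_unique vPsi fy yw fmin wf).
rewrite leNgt; apply/negP => /rat_in_itvoo[q]; rewrite in_itv/= => /andP[fq qw].
have [nS|[u [yu [Ku uq]]]] := hq q I.
  by apply: nS; exists (f y); split=> //; exact: ltW.
by have := lt_le_trans qw (wmin u (conj yu Ku)); rewrite ltNge uq.
Qed.

Lemma cusco_preimage_closed Phi (K : set 'rV[R]_l) : cusco Phi -> closed K ->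
  closed [set y | Phi y `&` K !=set0].
Proof.
move=> [usc _] cK; rewrite -openC openE => y /= yK.
have := usc y (~` K) (closed_openC cK).
have h : Phi y `<=` ~` K by move=> v yv Kv; apply: yK; exists v.
move=> /(_ h); apply: filterS => z zK [v [zv Kv]]; exact: zK zv Kv.
Qed.

(** Enumerate the pairs (p, q), take disjoint measurable pieces F k of the sets
    hits Phi p q, non-null when these are, and select from Phi y intersected with
    q for y in the piece of (p, q), from Phi y outside all pieces. *)
Lemma rich_selection Phi : cusco Phi ->
  exists f : 'rV[R]_d -> 'rV[R]_l, [/\ lebesgue_measurable_fun f,
    forall y, Phi y (f y) &
    forall p q, lebesgue_null (hits (fun y => [set f y]) p q) ->
                lebesgue_null (hits Phi p q)].
Proof.
move=> cPhi; pose I := (('rV[rat]_d * 'rV[rat]_d) * ('rV[rat]_l * 'rV[rat]_l))%type.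
pose E k : set 'rV[R]_d :=
  if unpickle k is Some pq then hits Phi (pq : I).1 pq.2 else set0.
pose Q k : set 'rV[R]_l :=
  if unpickle k is Some pq then rational_cbox (pq : I).2 else setT.
have cQ k : closed (Q k).
  by rewrite /Q; case: unpickle => [pq|]; [exact: rational_cbox_closed|exact: closedT].
have vQ k : convex_set (Q k).
  rewrite /Q; case: unpickle => [pq|]; first exact: rational_cbox_convex.
  by move=> v w t _ _; rewrite inE.
have EQ k y : E k y -> Phi y `&` Q k !=set0.
  by rewrite /E /Q; case: unpickle => [pq [] //|].
have mPhi K : closed K -> lebesgue_measurable [set y | Phi y `&` K !=set0].
  by move=> cK; exact/closed_lebesgue_measurable/cusco_preimage_closed.
have mE k : lebesgue_measurable (E k).
  rewrite /E; case: unpickle => [pq|]; last exact: lebesgue_measurable0.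
  apply: (@lebesgue_measurableI _ _ (rational_cbox pq.1)).
    exact/closed_lebesgue_measurable/rational_cbox_closed.
  by apply: mPhi; exact: rational_cbox_closed.
have [F [FE mF disjF nF]] := disjoint_pieces mE.
(* The pieces are disjoint, so C y is Q k on F k and everything off the pieces. *)
pose C y := \bigcap_(k in [set k | F k y]) Q k.
have CQ k y : F k y -> C y = Q k.
  move=> Fk; apply/seteqP; split=> [v /(_ k Fk)//|v Qv j Fj].
  have [->//|/disjF jk] := eqVneq j k.
  by have : (F j `&` F k) y by []; rewrite jk.
have CT y : ~ (\bigcup_k F k) y -> C y = setT.
  by move=> nFy; apply/seteqP; split=> // v _ k Fk; case: nFy; exists k.
have cC y : closed (C y) by apply: closed_bigI => k _.
have vC y : convex_set (C y).
  move=> v w t; rewrite !inE => Cv Cw k Fk; apply: set_mem.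
  by apply: vQ; rewrite inE; [exact: Cv|exact: Cw].
pose Psi y := Phi y `&` C y.
have [||f [mf fPsi]] := @measurable_selection Psi.
- move=> y; have [[v yv] cy vy] := cPhi.2 y; split.
  + have [[k _ Fk]|nFy] := pselect ((\bigcup_k F k) y).
      by rewrite /Psi (CQ k)//; apply: EQ; exact: FE.
    by rewrite /Psi CT// setIT; exists v.
  + exact: compact_closedI.
  + move=> u w t; rewrite !inE => -[yu Cu] [yw Cw]; split; apply: set_mem.
      by apply: vy; rewrite inE.
    by apply: vC; rewrite inE.
- move=> K cK.
  rewrite (_ : [set y | Psi y `&` K !=set0] =
    (\bigcup_k (F k `&` [set y | Phi y `&` (Q k `&` K) !=set0])) `|`
    ([set y | Phi y `&` K !=set0] `\` \bigcup_k F k)).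
    apply: lebesgue_measurableU.
      apply: lebesgue_measurable_bigcup => k _; apply: lebesgue_measurableI => //.
      by apply: mPhi; exact: closedI.
    apply: lebesgue_measurableD; first exact: mPhi.
    by apply: lebesgue_measurable_bigcup => k _.
  apply/seteqP; split=> y.
    rewrite /= /Psi => -[v [[yv Cv] Kv]].
    have [[k _ Fk]|nFy] := pselect ((\bigcup_k F k) y).
      by left; exists k => //; split=> //; exists v; rewrite -(CQ k y).
    by right; split=> //; exists v.
  rewrite /Psi => -[[k _ [Fk [v [yv [Qv Kv]]]]]|[[v [yv Kv]] nFy]] /=.
    by exists v; rewrite (CQ k).
  by exists v; rewrite CT.
exists f; split=> //; first by move=> y; have [] := fPsi y.
move=> p q; apply: contraPP => npq.
pose k := pickle ((p, q) : I).
have : ~ lebesgue_null (F k) by apply: nF; rewrite /E pickleK.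
apply: contra_not; apply: lebesgue_nullS => y Fk; split.
  by have := FE k y Fk; rewrite /E pickleK => -[].
exists (f y); split=> //; have [_] := fPsi y.
by rewrite (CQ k)// /Q pickleK.
Qed.

End measurable_selections.

Lemma filippov_regularizationE (R : realType) (d l : nat)
    (f : 'rV[R]_d -> 'rV[R]_l) :
  filippov_regularization f = m_map (fun y => [set f y]).
Proof.
apply/funext => x; apply: eq_bigcapr => N _; apply: eq_bigcapr => delta _.
by rewrite bigcup_imset1.
Qed.

Theorem theorem4p4 (R : realType) (d l : nat) (d_gt0 : (0 < d)%N)
    (Phi : 'rV[R]_d -> set 'rV[R]_l) (Phi_cusco : cusco Phi) :
  (filippov_representable Phi <-> forall x : 'rV[R]_d, Phi x = m_map Phi x) /\
  ((forall x : 'rV[R]_d, Phi x = m_map Phi x) <-> is_least_in_class Phi) /\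
  ((forall x : 'rV[R]_d, Phi x = m_map Phi x) <-> is_minimal_in_class Phi).
Proof.
case: d d_gt0 Phi Phi_cusco => [//|n] _ Phi cPhi.
have mPhi := m_map_le_cusco cPhi.
have m_class : cusco_class Phi (m_map Phi).
  by split; [exact: m_map_cusco|exact: m_map_ae_equal].
have eq_least : (forall x, Phi x = m_map Phi x) -> is_least_in_class Phi.
  move=> PhiE Psi [cPsi PsiPhi] x; rewrite PhiE => v mv.
  apply: (m_map_le_cusco cPsi); move: v mv; apply: m_map_le_ae.
  by apply: lebesgue_nullS PsiPhi => y /= h e; apply: h; rewrite e.
split; last split.
- split=> [[f [mf fE]] x|PhiE].
    apply/seteqP; split; last exact: mPhi.
    rewrite fE filippov_regularizationE; apply: m_map_le_ae.
    apply: lebesgue_nullS (ae_sub_m_map (fun y => [set f y])) => y /=.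
    by apply: contra_not; rewrite fE filippov_regularizationE.
  have [f [mf fPhi fhits]] := rich_selection cPhi.
  exists f; split=> // x; rewrite filippov_regularizationE.
  apply/seteqP; split; first by rewrite PhiE; exact: m_map_le_hits.
  rewrite PhiE; apply: m_map_le_ae.
  apply: lebesgue_nullS lebesgue_null0 => y /=; apply => v ->; exact: fPhi.
- split=> [//|least x]; apply/seteqP; split; last exact: mPhi.
  exact: least.
- split=> [PhiE Psi Psi_class Psi_le|minimal x].
    apply/funext => x; apply/seteqP; split; first exact: Psi_le.
    exact: eq_least.
  by rewrite {1}(minimal _ m_class mPhi).
Qed.
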